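(* There is an absolute constant $c$ such that for every connected unweighted planar graph $G$ with diameter $\Delta$ there is a set $\mathcal{F}$ of at most $2^{c\Delta}$ BFS forests of $G$ such that every path in $G$ of length at most $\Delta$ is preserved by $\mathcal{F}$. Consequently, for every $u,v\in V(G)$ there is a forest $F\in\mathcal{F}$ with $\mathrm{dist}_F(u,v)=\mathrm{dist}_G(u,v)$.
   Context: $G$ is unweighted (edge lengths 1). For a vertex set $S$, $G[S]$ is the induced subgraph. A tree $T\subseteq G$ (subgraph) rooted at $r$ is a BFS tree if $\mathrm{dist}_T(r,v)=\mathrm{dist}_{G[V(T)]}(r,v)$ for every $v\in V(T)$. A BFS forest is a subgraph of $G$ that is a disjoint union of vertex-disjoint BFS trees. A BFS tree $T$ with root $r$ preserves a path $\pi$ in $G$ if every vertex of $\pi$ lies in $V(T)$ and $\pi$ passes through $r$. A BFS forest preserves $\pi$ if one of its trees preserves $\pi$; a set of BFS forests preserves $\pi$ if one of its forests preserves $\pi$. For a forest $F$, $\mathrm{dist}_F(u,v)$ is the distance within the tree of $F$ containing both $u,v$ ($\infty$ if none). *)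

(* Defs.v *)
From mathcomp Require Import all_boot all_order all_algebra.
From mathcomp Require Import all_classical all_reals all_analysis.
From mathcomp Require Import Rstruct Rstruct_topology.
From Stdlib Require Rdefinitions.
Local Notation R := Rdefinitions.R.
Require Stdlib.Lists.List.

Set Implicit Arguments.
Unset Strict Implicit.
Unset Printing Implicit Defensive.

Import Order.TTheory GRing.Theory Num.Theory.

(* A (finite, simple, unweighted) graph is given by a finType T of vertices and a
   symmetric irreflexive adjacency relation e : rel T. *)

Section Graphs.
Variable T : finType.

(* dist_le f S u v k : there is a walk from u to v using f-edges, staying inside the
   vertex set S, with at most k edges; i.e. dist_{(S,f)}(u,v) <= k.
   Hence "dist_1 = dist_2" (with value infinity allowed) is
   forall k, dist_le .. k <-> dist_le .. k. *)
Definition dist_le (f : rel T) (S : {set T}) (u v : T) (k : nat) : Prop :=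
  exists p : seq T, [/\ path f u p, last u p = v, all (fun x => x \in S) (u :: p)
                      & size p <= k].

Definition is_diameter (e : rel T) (D : nat) : Prop :=
  (forall u v, dist_le e [set: T]%SET u v D) /\
  (exists u v, forall k, dist_le e [set: T]%SET u v k -> D <= k).

Definition planar (e : rel T) : Prop :=
  exists (pos : T -> (R * R)%type) (arc : T -> T -> R -> (R * R)%type),
  [/\ injective pos,
      (forall u v, e u v ->
         [/\ {within `[(0:R)%R, (1:R)%R], continuous (arc u v)}%classic,
             (forall s t : R, (0 <= s <= 1)%R -> (0 <= t <= 1)%R ->
                 arc u v s = arc u v t -> s = t),
             arc u v 0%R = pos u & arc u v 1%R = pos v]),
      (forall u v w, e u v -> forall t : R, (0 < t < 1)%R -> arc u v t <> pos w)
    & (forall u v x y, e u v -> e x y -> ~ ((u = x /\ v = y) \/ (u = y /\ v = x)) ->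
         forall s t : R, (0 < s < 1)%R -> (0 < t < 1)%R -> arc u v s <> arc x y t)].

Record rtree := RTree { rt_root : T; rt_verts : {set T}; rt_edges : rel T }.

Definition is_subtree (e : rel T) (t : rtree) : Prop :=
  [/\ rt_root t \in rt_verts t,
      (forall x y, rt_edges t x y -> [&& e x y, x \in rt_verts t & y \in rt_verts t]),
      (forall x y, rt_edges t x y = rt_edges t y x),
      (forall x y, x \in rt_verts t -> y \in rt_verts t ->
          exists p, path (rt_edges t) x p /\ last x p = y)
    &
      (forall x p, path (rt_edges t) x p -> uniq (x :: p) -> 2 <= size p ->
          ~~ rt_edges t (last x p) x)].

Definition is_bfs_tree (e : rel T) (t : rtree) : Prop :=
  is_subtree e t /\
  forall v, v \in rt_verts t -> forall k,
    dist_le (rt_edges t) (rt_verts t) (rt_root t) v k <->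
    dist_le e (rt_verts t) (rt_root t) v k.

Definition is_bfs_forest (e : rel T) (F : seq rtree) : Prop :=
  (forall t, List.In t F -> is_bfs_tree e t) /\
  pairwise (fun t1 t2 => [disjoint rt_verts t1 & rt_verts t2]) F.

Definition tree_preserves (t : rtree) (pi : seq T) : Prop :=
  all (fun x => x \in rt_verts t) pi /\ rt_root t \in pi.

Definition forest_preserves (F : seq rtree) (pi : seq T) : Prop :=
  exists t, List.In t F /\ tree_preserves t pi.

Definition forests_preserve (FF : seq (seq rtree)) (pi : seq T) : Prop :=
  exists F, List.In F FF /\ forest_preserves F pi.

(* dist_F(u, v) = dist_G(u, v): some tree of F contains u and v, and the distance in that
   tree equals the distance in G (dist_F is infinite if no tree contains both). *)
Definition forest_dist_eq (e : rel T) (F : seq rtree) (u v : T) : Prop :=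
  exists t, [/\ List.In t F, u \in rt_verts t, v \in rt_verts t &
    forall k, dist_le (rt_edges t) (rt_verts t) u v k <-> dist_le e [set: T]%SET u v k].

End Graphs.

(* Main.v *)
Require Import Defs.
From mathcomp Require Import all_boot all_order all_algebra.
From mathcomp Require Import all_classical all_reals all_analysis.
Require Stdlib.Lists.List.
From Stdlib Require Import Btauto.
From mathcomp Require Import Rstruct Rstruct_topology lra zify.

(** Topology enters only through the absence of a [K_5] minor.  Sampling the arcs
    of a drawing and rounding to a fine grid turns edges into lattice walks such
    that vertex-disjoint edges give disjoint walks, and a mod 2 count of
    crossings with half-lines shows that [K_5] has no such lattice drawing.

    A [K_5]-minor-free graph is cut into parts one after the other: from a
    component [C] of what remains, remove a union of at most three geodesics of
    [C] with a common end that meets the neighbourhood of every earlier part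
    adjacent to [C].  The earlier parts adjacent to a component are connected and
    pairwise adjacent, so together with the component they form a clique minor
    and there are at most three of them.

    Write [idx v] for the step at which [v] is removed.  A path of length at most
    [D] lies in the ball of radius [D] around its vertex [r] of least [idx], taken
    among the vertices with index at least [idx r].  If the balls of [r] and [r']
    meet and [idx r < idx r'], a walk of length at most [2D] from [r'] to [r]
    leaves components only through adjacent parts, hence the part of [r] is one
    of at most [4^(2D)] parts seen from that of [r']; if [idx r = idx r'], they
    are at distance at most [2D].  So boundedly many colours, [2^O(D)], make balls
    of equally coloured centres disjoint; each colour gives a forest of BFS trees. *)

Set Implicit Arguments.
Unset Strict Implicit.
Unset Printing Implicit Defensive.

(** * Lattice walks and [K_5] *)

Section Lattice.
Import Order.TTheory GRing.Theory Num.Theory.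

Definition lstep (p q : int * int) : bool :=
  ((p.1 == q.1) && (`|p.2 - q.2| <= 1)%R) || ((p.2 == q.2) && (`|p.1 - q.1| <= 1)%R).

(* The step from [q] to [q'] meets the upward half-line from [p], shifted by half
   a unit to the left. *)
Definition crosses (q q' p : int * int) : bool :=
  ((q.1 < p.1)%R (+) (q'.1 < p.1)%R) && (p.2 < q.2)%R.

Definition lexlt (p q : int * int) : bool :=
  (p.1 < q.1)%R || ((p.1 == q.1) && (p.2 < q.2)%R).

Fixpoint crossing (c : int * int) (s : seq (int * int)) (p : int * int) : bool :=
  if s is q :: s' then crosses c q p (+) crossing q s' p else false.

Lemma addb_xorb (a b : bool) : a (+) b = xorb a b.
Proof. by case: a. Qed.

(** Adds two identities mod 2, leaving a tautology for [btauto] in which the repeated terms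
    cancel. *)
Lemma addb_comb2 (a1 b1 a2 b2 a b : bool) :
  a1 = b1 -> a2 = b2 -> a (+) b = (a1 (+) b1) (+) (a2 (+) b2) -> a = b.
Proof. by move=> -> ->; rewrite !addbb; case: a; case: b. Qed.

Lemma lstepP (p q : int * int) : lstep p q -> q = p \/
  [\/ q = (p.1 + 1, p.2)%R, p = (q.1 + 1, q.2)%R, q = (p.1, p.2 + 1)%R | p = (q.1, q.2 + 1)%R].
Proof.
move: p q => [x y] [x' y']; rewrite /lstep /=.
case/orP => /andP[/eqP-> h].
  have [->|[]->] : y' = y \/ (y' = (y + 1)%R \/ y = (y' + 1)%R) by lia.
  - by left.
  - by right; constructor 3.
  - by right; constructor 4.
have [->|[]->] : x' = x \/ (x' = (x + 1)%R \/ x = (x' + 1)%R) by lia.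
- by left.
- by right; constructor 1.
- by right; constructor 2.
Qed.

(** Each step is stationary or one of four unit moves, so integer arithmetic settles twenty-five
    cases. Longer walks follow by adding this local identity up mod 2: the terms at inner vertices
    cancel. *)
Lemma crosses_steps (p p' c c' : int * int) :
  lstep p p' -> lstep c c' -> p != c -> p != c' -> p' != c -> p' != c' ->
  crosses c c' p (+) crosses c c' p' (+) crosses p p' c (+) crosses p p' c' =
  lexlt c p (+) lexlt c p' (+) lexlt c' p (+) lexlt c' p'.
Proof.
move: p p' c c' => [p1 p2] [q1 q2] [c1 c2] [d1 d2].
move=> /lstepP H1 /lstepP H2; rewrite /crosses /lexlt !xpair_eqE /=.
case: H1 => [[-> ->]|[] [-> ->]]; case: H2 => [[-> ->]|[] [-> ->]]; clear;
  by rewrite /= ?ltxx ?addbb /= ?addbF ?addbb //=; lia.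
Qed.

Lemma crosses_walk (p p' c : int * int) (Q : seq (int * int)) :
  lstep p p' -> path lstep c Q -> p \notin c :: Q -> p' \notin c :: Q ->
  crossing c Q p (+) crossing c Q p' (+) crosses p p' c (+) crosses p p' (last c Q) =
  lexlt c p (+) lexlt c p' (+) lexlt (last c Q) p (+) lexlt (last c Q) p'.
Proof.
move=> stp; elim: Q c => [|q Q IH] c /=.
  by move=> _ _ _; rewrite !addb_xorb; btauto.
move=> /andP[stc walkQ]; rewrite inE negb_or => /andP[pc pQ].
rewrite inE negb_or => /andP[p'c p'Q].
have /andP[pq _] : (p != q) && (p \notin Q) by rewrite -negb_or -in_cons.
have /andP[p'q _] : (p' != q) && (p' \notin Q) by rewrite -negb_or -in_cons.
apply: (addb_comb2 (IH q walkQ pQ p'Q) (crosses_steps stp stc pc pq p'c p'q)).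
rewrite !addb_xorb; btauto.
Qed.

(* Prolong [P] and [Q] upwards from their end points.  The left-hand side counts
   how often each walk meets a prolongation of the other one; as the walks are
   disjoint, its parity is that of the crossings of the prolonged curves at
   infinity. *)
Lemma crossing_disjoint_walks (a c : int * int) (P Q : seq (int * int)) :
  path lstep a P -> path lstep c Q ->
  (forall p, p \in a :: P -> p \notin c :: Q) ->
  crossing c Q a (+) crossing c Q (last a P) (+)
  (crossing a P c (+) crossing a P (last c Q)) =
  lexlt c a (+) lexlt (last c Q) a (+) (lexlt c (last a P) (+) lexlt (last c Q) (last a P)).
Proof.
move=> walkP walkQ; elim: P a walkP => [|p P IH] a /=.
  by move=> _ _; rewrite !addbb.
move=> /andP[sta walkP] disj.
have [aQ pQ] : a \notin c :: Q /\ p \notin c :: Q by split; apply: disj; rewrite !inE eqxx ?orbT.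
have {}IH := IH p walkP (fun q h => disj q (@mem_behead _ (a :: p :: P) q h)).
apply: (addb_comb2 IH (crosses_walk sta walkQ aQ pQ)).
rewrite !addb_xorb; btauto.
Qed.

Lemma lexlt_asym (p q : int * int) : p != q -> lexlt q p = ~~ lexlt p q.
Proof. by move: p q => [x y] [x' y']; rewrite /lexlt xpair_eqE /=; lia. Qed.

(* The strong form of the nonplanarity of [K_5]: only independent edges are
   required to be disjoint.  Summing [crossing_disjoint_walks] over the 15
   independent pairs, every crossing term occurs twice, whereas each of the ten
   comparisons of end points occurs three times in each direction. *)
Lemma lattice_K5 (p : 'I_5 -> int * int) (W : 'I_5 -> 'I_5 -> seq (int * int)) :
  (forall i j, i != j -> path lstep (p i) (W i j) /\ last (p i) (W i j) = p j) ->
  (forall i j k l, uniq [:: i; j; k; l] ->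
     forall q, q \in p i :: W i j -> q \notin p k :: W k l) ->
  False.
Proof.
move=> walk disj.
pose o k (lt_k5 : k < 5) := Ordinal lt_k5.
(* The points [p i] and [p k] differ because they lie on the disjoint walks of two independent
   edges. *)
have asym i j k l : uniq [:: i; j; k; l] -> lexlt (p k) (p i) = ~~ lexlt (p i) (p k).
  move=> uq; apply: lexlt_asym; apply/eqP => eq_ik.
  by have := disj i j k l uq (p i) (mem_head _ _); rewrite eq_ik mem_head.
have eqn i j k l (uq : uniq [:: i; j; k; l]) :
    crossing (p k) (W k l) (p i) (+) crossing (p k) (W k l) (p j) (+)
    (crossing (p i) (W i j) (p k) (+) crossing (p i) (W i j) (p l)) =
    lexlt (p k) (p i) (+) lexlt (p l) (p i) (+) (lexlt (p k) (p j) (+) lexlt (p l) (p j)).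
  have [ij kl] : i != j /\ k != l.
    by move: uq; rewrite /= !inE !negb_or => /and4P[/and3P[-> _ _] _ -> _].
  have [wi li] := walk i j ij; have [wk lk] := walk k l kl.
  by have := crossing_disjoint_walks wi wk (disj i j k l uq); rewrite li lk.
pose a := @o 0 isT; pose b := @o 1 isT; pose c := @o 2 isT; pose d := @o 3 isT; pose e := @o 4 isT.
have E1 := eqn a b c d isT; have E2 := eqn a c b d isT; have E3 := eqn a d b c isT.
have E4 := eqn a b c e isT; have E5 := eqn a c b e isT; have E6 := eqn a e b c isT.
have E7 := eqn a b d e isT; have E8 := eqn a d b e isT; have E9 := eqn a e b d isT.
have E10 := eqn a c d e isT; have E11 := eqn a d c e isT; have E12 := eqn a e c d isT.
have E13 := eqn b c d e isT; have E14 := eqn b d c e isT; have E15 := eqn b e c d isT.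
have ba := asym a c b d isT; have ca := asym a b c d isT; have da := asym a b d c isT.
have ea := asym a b e c isT; have cb := asym b a c d isT; have db := asym b a d c isT.
have eb := asym b a e c isT; have dc := asym c a d b isT; have ec := asym c a e b isT.
have ed := asym d a e b isT.
rewrite ?ba ?ca ?da ?ea ?cb ?db ?eb ?dc ?ec ?ed
  in E1 E2 E3 E4 E5 E6 E7 E8 E9 E10 E11 E12 E13 E14 E15.
have comb x y z w : x = y -> z = w -> x (+) z = y (+) w by move=> -> ->.
(* On the right, a pair containing [a] is always compared in the same direction; [b] and one of [c],
   [d], [e] are compared four times one way and twice the other; each pair among [c], [d], [e] three
   times each way. Only these last three pairs contribute, one each, so the sum is odd. *)
have := comb _ _ _ _ (comb _ _ _ _ (comb _ _ _ _ E1 E2) (comb _ _ _ _ E3 E4))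
                     (comb _ _ _ _ (comb _ _ _ _ E5 E6) (comb _ _ _ _ E7 E8)).
move=> /comb/(_ (comb _ _ _ _ (comb _ _ _ _ (comb _ _ _ _ E9 E10) (comb _ _ _ _ E11 E12))
                              (comb _ _ _ _ (comb _ _ _ _ E13 E14) E15))).
have ne x y : x (+) y = true -> x = y -> False by case: x; case: y.
by apply: ne; rewrite !addb_xorb; btauto.
Qed.

End Lattice.

(** * From planar drawings to lattice walks *)

Section Drawing.
Import Order.TTheory GRing.Theory Num.Theory.
Import numFieldNormedType.Exports.

Section Arcs.
Local Open Scope classical_set_scope.
Local Open Scope ring_scope.
Variable R : realType.
Implicit Types (f g : R -> R * R).

(** Precomposition with this retraction makes an arc continuous on the whole line, whose
    connectedness can then be used. *)
Definition clamp (t : R) : R := Num.max 0 (Num.min 1 t).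

Lemma clamp_itv (t : R) : 0 <= clamp t <= 1.
Proof. by rewrite /clamp le_max lexx /= ge_max ler01 ge_min lexx. Qed.

Lemma clamp_id (t : R) : 0 <= t <= 1 -> clamp t = t.
Proof. by rewrite /clamp => /andP[t0 t1]; rewrite min_r // max_r. Qed.

Lemma clamp_continuous : continuous clamp.
Proof.
move=> t; apply: (@continuous_max _ _ (fun=> 0) (fun s : R => Num.min 1 s)).
  exact: cst_continuous.
apply: (@continuous_min _ _ (fun=> 1) id); first exact: cst_continuous.
by move=> ?; exact: cvg_id.
Qed.

Lemma arc_clamp_continuous f :
  {within `[0, 1], continuous f} -> continuous (f \o clamp).
Proof.
move=> /subspace_continuousP cf t.
have inI s : `[0%R, 1%R]%classic (clamp s) by rewrite /= in_itv /=; exact: clamp_itv.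
apply: (cvg_comp _ _ _ (cf _ (inI t))) => A hA.
have := @clamp_continuous t _ hA.
exact: (@filterS _ (nbhs t) _ _ _ (fun s h => h (inI s))).
Qed.

(** The set of all distances [|f s - g t|] is a continuous image of a compact set, hence closed; as
    it misses 0, it misses a ball around 0. *)
Lemma arcs_distance f g :
  {within `[0, 1], continuous f} -> {within `[0, 1], continuous g} ->
  (forall s t, 0 <= s <= 1 -> 0 <= t <= 1 -> f s <> g t) ->
  exists2 d : R, 0 < d & forall s t, 0 <= s <= 1 -> 0 <= t <= 1 -> d <= `|f s - g t|.
Proof.
move=> cf cg fg.
pose I : set R := `[0, 1]%classic.
have cptI : compact I by exact: segment_compact.
pose dist (z : (R * R) * (R * R)) : R := `|z.1 - z.2|.
have cdist : continuous dist.
  move=> z; rewrite /dist; apply: (@cvg_norm _ (R * R)%type).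
  by apply: cvgB; [exact: cvg_fst | exact: cvg_snd].
have cptD : compact (dist @` ((f @` I) `*` (g @` I))).
  apply: continuous_compact; first by apply: continuous_subspaceT.
  by apply: compact_setX; apply: continuous_compact.
have clD : closed (dist @` ((f @` I) `*` (g @` I))).
  by apply: compact_closed => //; exact: Rhausdorff.
have : (~` (dist @` ((f @` I) `*` (g @` I)))) 0.
  move=> [[a b] /= [[s sI <-] [t tI <-]]] /eqP; rewrite /dist /= normr_eq0 subr_eq0 => /eqP.
  by apply: fg; [move: sI | move: tI]; rewrite /I /= in_itv.
have := closed_openC clD; rewrite openE => /[apply] /nbhs_ballP[d /= d0 hd].
exists d => // s t sI tI; rewrite leNgt; apply/negP => lt_d.
apply: (hd `|f s - g t|); first by rewrite /ball /= sub0r normrN normr_id.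
exists (f s, g t) => //=; split; [exists s | exists t] => //; by rewrite /I /= in_itv.
Qed.

(** The parameters reachable from 0 by such chains form a nonempty set that is open and closed,
    hence the whole line. The chain need be neither monotone nor contained in [[0, 1]]. *)
Lemma arc_chain f (h : R) : {within `[0, 1], continuous f} -> 0 < h ->
  exists2 p : seq R, path (fun a b => `|f (clamp a) - f (clamp b)| < h) 0 p & last 0 p = 1.
Proof.
move=> cf h0.
pose B : set R := [set t | exists2 p : seq R,
  path (fun a b => `|f (clamp a) - f (clamp b)| < h) 0 p & last 0 p = t].
have near_t t : \forall s \near t, `|f (clamp t) - f (clamp s)| < h.
  have cft : {for t, continuous (f \o clamp)} by exact: arc_clamp_continuous.
  by move/(@cvgrPdist_lt _ (R * R)%type) : cft => /(_ _ h0).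
have step t s : B t -> `|f (clamp t) - f (clamp s)| < h -> B s.
  move=> [p pp lp] ts; exists (rcons p s); last by rewrite last_rcons.
  by rewrite rcons_path pp lp.
have connR : connected [set: R] by apply/connected_intervalP.
suff BT : B = [set: R] by have : B 1 by rewrite BT.
have oB : open B.
  rewrite openE => t Bt; apply: filterS (near_t t) => s; exact: step.
have cB : closed B.
  rewrite -openC openE => t Bt; apply: filterS (near_t t) => s.
  by rewrite distrC => ts Bs; apply: Bt; apply: step ts.
apply: connR.
- by exists 0, [::].
- by exists B => //; rewrite setTI.
- by exists B => //; rewrite setTI.
Qed.

End Arcs.

Section Rounding.
Local Open Scope ring_scope.
Variables (R : realType) (h : R).
Hypothesis h0 : 0 < h.

Definition cell (x : R) : int := Num.floor (x / h).

Lemma cell_eq (x y : R) : cell x = cell y -> `|x - y| < h.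
Proof.
have /andP[x1 x2] := floor_itv (x / h); have /andP[y1 y2] := floor_itv (y / h).
rewrite /cell => eq_xy; rewrite eq_xy in x1 x2.
have -> : x - y = (x / h - y / h) * h by rewrite -mulrBl divfK ?gt_eqF.
rewrite normrM (gtr0_norm h0) gtr_pMl // ltr_norml; rewrite intrD in x2 y2; lra.
Qed.

Lemma cell_near (x y : R) : `|x - y| < h -> `|cell x - cell y| <= 1.
Proof.
have /andP[x1 x2] := floor_itv (x / h); have /andP[y1 y2] := floor_itv (y / h).
rewrite -/(cell x) -/(cell y) in x1 x2 y1 y2.
have {1}-> : x - y = (x / h - y / h) * h by rewrite -mulrBl divfK ?gt_eqF.
rewrite normrM (gtr0_norm h0) gtr_pMl // ltr_norml => /andP[lo hi].
have lt1 : (cell x)%:~R < (cell y + 2)%:~R :> R by rewrite intrD in y2 *; lra.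
have lt2 : (cell y)%:~R < (cell x + 2)%:~R :> R by rewrite intrD in x2 *; lra.
rewrite !ltr_int in lt1 lt2; lia.
Qed.

Definition cell2 (q : R * R) : int * int := (cell q.1, cell q.2).

(** The cells of two consecutive samples may differ in both coordinates, so a corner is inserted:
    first the first coordinate moves, then the second. *)
Fixpoint staircase (q : R * R) (s : seq (R * R)) : seq (int * int) :=
  if s is q' :: s' then
    [:: (cell q'.1, cell q.2), cell2 q' & staircase q' s']
  else [::].

Lemma norm_pair_lt (q : R * R) : (`|q| < h) = (`|q.1| < h) && (`|q.2| < h).
Proof. by rewrite prod_normE gt_max. Qed.

Lemma staircase_walk (q : R * R) (s : seq (R * R)) :
  path (fun a b => `|a - b| < h) q s ->
  path lstep (cell2 q) (staircase q s) /\ last (cell2 q) (staircase q s) = cell2 (last q s).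
Proof.
elim: s q => [|q' s IH] q //= /andP[]; rewrite norm_pair_lt /= => /andP[h1 h2] /IH[-> ->].
split => //; rewrite andbT /lstep /= !eqxx !cell_near ?orbT //.
all: by rewrite subrr normr0.
Qed.

Lemma staircase_near (q : R * R) (s : seq (R * R)) z :
  path (fun a b => `|a - b| < h) q s -> z \in cell2 q :: staircase q s ->
  exists a b, [/\ a \in q :: s, b \in q :: s, `|a - b| < h & z = (cell b.1, cell a.2)].
Proof.
have diag a t : a \in t -> z = cell2 a ->
    exists a b, [/\ a \in t, b \in t, `|a - b| < h & z = (cell b.1, cell a.2)].
  by move=> at_ ->; exists a, a; rewrite subrr normr0.
elim: s q => [|q' s IH] q /=.
  by move=> _; rewrite inE => /eqP; apply: diag; rewrite mem_head.
move=> /andP[qq' pth]; rewrite inE => /predU1P[|].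
  by apply: diag; rewrite mem_head.
rewrite inE => /predU1P[->|]; first by exists q, q'; rewrite !inE !eqxx ?orbT.
by move=> /(IH _ pth)[a [b [aq bq ab ->]]]; exists a, b; rewrite inE aq orbT inE bq orbT.
Qed.

(** A common lattice point is made of the first cell of [b] and [b'] and the second cell of [a] and
    [a']. Passing from [a] to [b], [b'], [a'] bounds the first coordinates of [a] and [a'] to within
    [3 * h], and their second coordinates differ by less than [h]. *)
Lemma staircase_disjoint (q q' : R * R) (s s' : seq (R * R)) :
  path (fun a b => `|a - b| < h) q s -> path (fun a b => `|a - b| < h) q' s' ->
  (forall a b, a \in q :: s -> b \in q' :: s' -> 3 * h <= `|a - b|) ->
  forall z, z \in cell2 q :: staircase q s -> z \notin cell2 q' :: staircase q' s'.
Proof.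
move=> p1 p2 far z /(staircase_near p1)[a [b [aq bq ab ->]]].
apply/negP => /(staircase_near p2)[a' [b' [aq' bq' ab' [/cell_eq e1 /cell_eq e2]]]].
have := far _ _ aq aq'; apply/negP; rewrite -ltNge prod_normE gt_max.
move: ab ab' e1 e2; rewrite !norm_pair_lt /= !ltr_norml.
move=> /andP[/andP[? ?] /andP[? ?]] /andP[/andP[? ?] /andP[? ?]] /andP[? ?] /andP[? ?].
lra.
Qed.

End Rounding.

Lemma finite_uniform (R : realType) (I : finType) (P : I -> R -> Prop) :
  (forall i d d', (d' <= d)%R -> P i d -> P i d') ->
  (forall i, exists2 d : R, (0 < d)%R & P i d) ->
  exists2 d : R, (0 < d)%R & forall i, P i d.
Proof.
move=> mono ex; suff [d d0 Pd] : exists2 d : R, (0 < d)%R & forall i, i \in enum I -> P i d.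
  by exists d => // i; apply: Pd; rewrite mem_enum.
elim: (enum I) => [|i s [d d0 Pd]]; first by exists 1%R; rewrite ?ltr01.
have [d' d'0 Pd'] := ex i; exists (Num.min d d'); first by rewrite lt_min d0.
move=> j; rewrite inE => /predU1P[->|js].
  by apply: mono Pd'; rewrite ge_min lexx orbT.
by apply: mono (Pd j js); rewrite ge_min lexx.
Qed.

Local Notation R := Rdefinitions.R.

Definition vertex_disjoint (T : eqType) (u v x y : T) : bool :=
  [&& u != x, u != y, v != x & v != y].

Lemma planar_lattice_drawing (T : finType) (e : rel T) : planar e ->
  exists (loc : T -> int * int) (W : T -> T -> seq (int * int)),
    (forall u v, e u v -> path lstep (loc u) (W u v) /\ last (loc u) (W u v) = loc v) /\
    (forall u v x y, e u v -> e x y -> vertex_disjoint u v x y ->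
       forall q, q \in loc u :: W u v -> q \notin loc x :: W x y).
Proof.
move=> [pos [arc [posI arcs avoid indep]]].
(* [planar] separates only open arcs. For closed ones, two end points are told apart by injectivity
   of [pos], and an end point from an inner point by [avoid]. *)
have arcs_disj u v x y s t : e u v -> e x y -> vertex_disjoint u v x y ->
    (0 <= s <= 1)%R -> (0 <= t <= 1)%R -> arc u v s <> arc x y t.
  move=> uv xy /and4P[ux uy vx vy].
  have [_ _ u0 v1] := arcs _ _ uv; have [_ _ x0 y1] := arcs _ _ xy.
  have ends (a : R) : (0 <= a <= 1)%R -> [\/ a = 0%R, a = 1%R | (0 < a < 1)%R].
    rewrite !le_eqVlt => /andP[/predU1P[<-|a0]]; first by constructor 1.
    by move=> /predU1P[->|a1]; [constructor 2 | constructor 3; rewrite a0].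
  move=> /ends s01 /ends t01 eq_st.
  case: s01 t01 eq_st => [->|->|s01] [->|->|t01]; rewrite ?u0 ?v1 ?x0 ?y1.
  all: try by move/posI/eqP; apply/negP.
  all: try by apply: (avoid _ _ _ uv).
  all: try by move/esym; apply: (avoid _ _ _ xy).
  apply: indep => //.
  by move=> [[/eqP]|[/eqP]]; [rewrite (negPf ux)|rewrite (negPf uy)].
pose P (i : (T * T) * (T * T)) (d : R) := e i.1.1 i.1.2 -> e i.2.1 i.2.2 ->
  vertex_disjoint i.1.1 i.1.2 i.2.1 i.2.2 ->
  forall s t, (0 <= s <= 1)%R -> (0 <= t <= 1)%R -> (d <= `|arc i.1.1 i.1.2 s - arc i.2.1 i.2.2 t|)%R.
have [d d0 Pd] : exists2 d : R, (0 < d)%R & forall i, P i d.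
  apply: finite_uniform => [i d d' le_dd' Pd uv xy dis s t s01 t01|[[u v] [x y]]].
    exact: le_trans le_dd' (Pd uv xy dis s t s01 t01).
  rewrite /P /=; case: (boolP [&& e u v, e x y & vertex_disjoint u v x y]); last first.
    move=> nh; exists 1%R; first exact: ltr01.
    by move=> uv xy dis; move: nh; rewrite uv xy dis.
  move=> /and3P[uv xy dis]; have [cu _ _ _] := arcs _ _ uv; have [cx _ _ _] := arcs _ _ xy.
  have [d d0 hd] := arcs_distance cu cx (fun s t => @arcs_disj u v x y s t uv xy dis).
  by exists d.
(* A lattice point on a staircase shares each coordinate cell with a sample
   point, and these two samples are less than [h] apart, hence the factor 3. *)
pose h : R := (d / 3)%R.
have h0 : (0 < h)%R by rewrite divr_gt0.
have chains : forall z : T * T, exists p : seq R, e z.1 z.2 ->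
    path (fun a b => `|arc z.1 z.2 (clamp a) - arc z.1 z.2 (clamp b)| < h)%R 0%R p /\ last 0%R p = 1%R.
  move=> [u v] /=; case: (boolP (e u v)) => uv; last by exists [::].
  have [cu _ _ _] := arcs _ _ uv.
  by have [p pp lp] := arc_chain cu h0; exists p.
have {chains}[p hp] := choice chains.
pose W u v := staircase h (pos u) [seq arc u v (clamp a) | a <- p (u, v)].
exists (fun u => cell2 h (pos u)), W.
have clamp0 : clamp (0 : R)%R = 0%R by rewrite clamp_id // lexx ler01.
have clamp1 : clamp (1 : R)%R = 1%R by rewrite clamp_id // lexx ler01.
have chainW u v : e u v ->
    path (fun a b => `|a - b| < h)%R (pos u) [seq arc u v (clamp a) | a <- p (u, v)].
  move=> uv; have [_ _ <- _] := arcs _ _ uv; have [pp _] := hp (u, v) uv.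
  by rewrite -{1}clamp0 (@path_map _ _ (fun a => arc u v (clamp a))).
split=> [u v uv|u v x y uv xy dis].
  have [-> ->] := staircase_walk h0 (chainW u v uv); split => //.
  have [_ _ <- <-] := arcs _ _ uv; have [_ lp] := hp (u, v) uv.
  by rewrite -{1}clamp0 (@last_map _ _ (fun a => arc u v (clamp a))) lp clamp1.
apply: (staircase_disjoint h0 (chainW u v uv) (chainW x y xy)) => a b.
have on_arc u' v' c : e u' v' -> c \in pos u' :: [seq arc u' v' (clamp a) | a <- p (u', v')] ->
    exists2 s, (0 <= s <= 1)%R & c = arc u' v' s.
  move=> uv'; have [_ _ <- _] := arcs _ _ uv'; rewrite inE => /predU1P[->|/mapP[s _ ->]].
    by exists 0%R; rewrite ?lexx ?ler01.
  by exists (clamp s); rewrite ?clamp_itv.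
move=> /(on_arc _ _ _ uv)[s s01 ->] /(on_arc _ _ _ xy)[t t01 ->].
have := Pd ((u, v), (x, y)) uv xy dis s t s01 t01; apply: le_trans.
by rewrite /h mulrC divfK.
Qed.

End Drawing.

(** * Connectivity and breadth-first search *)

Section Connectivity.
Variables (T : finType) (e : rel T).
Implicit Types (A B S : {set T}) (x y u v : T) (p : seq T).

Definition within_rel S : rel T := fun x y => [&& e x y, x \in S & y \in S].

Definition connected_in S := forall x y, x \in S -> y \in S -> connect (within_rel S) x y.

Definition adjacent A B := exists x y, [/\ x \in A, y \in B & e x y].

Lemma within_relS A B : A \subset B -> subrel (connect (within_rel A)) (connect (within_rel B)).
Proof.
move=> /fintype.subsetP AB; apply: connect_sub => x y /and3P[exy xA yA].
by apply: connect1; rewrite /within_rel exy !AB.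
Qed.

Lemma within_path S x p :
  x \in S -> path (within_rel S) x p = path e x p && all (mem S) (x :: p).
Proof.
elim: p x => [|y p IH] x xS /=; first by rewrite xS.
rewrite /within_rel xS /=; case: (boolP (y \in S)) => yS; last by rewrite !andbF.
by rewrite andbT IH //= yS andbA.
Qed.

Lemma connect_withinP S x y : x \in S ->
  reflect (exists p, [/\ path e x p, last x p = y & all (mem S) (x :: p)])
          (connect (within_rel S) x y).
Proof.
move=> xS; apply: (iffP connectP) => [[p]|[p [pp <- pS]]].
  by rewrite within_path // => /andP[pp pS ->]; exists p.
by exists p; rewrite ?within_path ?pp.
Qed.

Lemma connect_within_mem S x y : x \in S -> connect (within_rel S) x y -> y \in S.
Proof.
by move=> xS /connect_withinP -/(_ xS)[p [_ <- /allP pS]]; apply: pS; exact: mem_last.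
Qed.

Hypothesis symE : symmetric e.

Lemma within_sym S : connect_sym (within_rel S).
Proof. by apply: sym_connect_sym => x y; rewrite /within_rel symE [(x \in S) && _]andbC. Qed.

Definition component S x : {set T} := [set y | connect (within_rel S) x y]%SET.

Lemma component_sub S x : x \in S -> component S x \subset S.
Proof. by move=> xS; apply/fintype.subsetP => y; rewrite inE => /(connect_within_mem xS). Qed.

(** A walk in [S] that starts in the component never leaves it, so it is also a walk of the induced
    subgraph. *)
Lemma component_connected S x : x \in S -> connected_in (component S x).
Proof.
move=> xS; have xC : x \in component S x by rewrite inE connect0.
have stays p u : u \in component S x -> path e u p -> all (mem S) (u :: p) ->
    all (mem (component S x)) (u :: p).
  elim: p u => [|z p IH] u uC /=; first by rewrite uC.
  move=> /andP[uz pp] /and3P[uS zS pS]; rewrite uC /=.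
  apply: (IH z) => //; last by rewrite /= zS.
  move: uC; rewrite !inE => /connect_trans; apply; apply: connect1.
  by rewrite /within_rel uz uS.
have toC y : y \in component S x -> connect (within_rel (component S x)) x y.
  rewrite inE => /(connect_withinP _ xS)[p [pp lp pS]].
  by apply/(connect_withinP _ xC); exists p; split=> //; exact: stays.
by move=> y z yC zC; apply: connect_trans (toC z zC); rewrite within_sym; exact: toC.
Qed.

Lemma rev_walk x p : path e x p ->
  exists q, [/\ path e (last x p) q, last (last x p) q = x,
    last x p :: q =i x :: p & size q = size p].
Proof.
move=> pp; exists (rev (belast x p)); split.
- by rewrite rev_path; apply: sub_path pp => y z; rewrite symE.
- by case: (p) => [|y p'] //=; rewrite rev_cons last_rcons.
- by move=> y; rewrite -rev_rcons -lastI mem_rev.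
- by rewrite size_rev size_belast.
Qed.

Lemma dist_le_sym S u v k : dist_le e S u v k -> dist_le e S v u k.
Proof.
move=> [p [/rev_walk[q [pq lq qp sq]] <- pS sp]]; exists q; split; rewrite ?sq //.
by rewrite (eq_all_r qp).
Qed.

Lemma adjacent_sym A B : adjacent A B -> adjacent B A.
Proof. by move=> [x [y [xA yB xy]]]; exists y, x; rewrite symE. Qed.

Lemma adjacent_walk A B x y : connected_in A -> connected_in B -> adjacent A B ->
  x \in A -> y \in B -> exists p, [/\ path e x p, last x p = y & all (mem (A :|: B)) (x :: p)].
Proof.
move=> cA cB [a [b [aA bB ab]]] xA yB.
apply/connect_withinP; first by rewrite inE xA.
apply: (@connect_trans _ _ a); first by apply: within_relS (cA _ _ xA aA); exact: finset.subsetUl.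
apply: (@connect_trans _ _ b); last by apply: within_relS (cB _ _ bB yB); exact: finset.subsetUr.
by apply: connect1; rewrite /within_rel ab !inE aA bB orbT.
Qed.

End Connectivity.

(** * Planar graphs have no [K_5] minor *)

Fixpoint walk_lift (T : Type) (W : T -> T -> seq (int * int)) (x : T) (p : seq T) :=
  if p is y :: p' then W x y ++ walk_lift W y p' else [::].

(* Branch paths [i -> j] stay in [B i :|: B j], so independent pairs of indices
   give disjoint lattice walks; overlaps of the other pairs are harmless. *)
Lemma planar_K5_minor_free (T : finType) (e : rel T) (B : 'I_5 -> {set T}) :
  symmetric e -> planar e ->
  (forall i, B i != finset.set0) -> (forall i, connected_in e (B i)) ->
  (forall i j, i != j -> [disjoint B i & B j]) ->
  (forall i j, i != j -> adjacent e (B i) (B j)) -> False.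
Proof.
move=> symE /planar_lattice_drawing[loc [W [walkW disjW]]] ne conn disj adj.
have liftP x p : path e x p ->
    path lstep (loc x) (walk_lift W x p) /\ last (loc x) (walk_lift W x p) = loc (last x p).
  elim: p x => [|y p IH] x //= /andP[xy /IH[pp lp]].
  by have [pW lW] := walkW x y xy; rewrite cat_path last_cat lW pW.
have lift_mem x p q : path e x p -> p != [::] -> q \in loc x :: walk_lift W x p ->
    exists u v, [/\ u \in x :: p, v \in x :: p, e u v & q \in loc u :: W u v].
  elim: p x => [|y p IH] x //= /andP[xy pp] _; rewrite -cat_cons mem_cat => /orP[qW|qp].
    by exists x, y; rewrite !inE !eqxx !orbT.
  case: p IH pp qp => [|z p] IH pp qp //.
  have [|u [v [up vp uv qW]]] := IH y pp isT; first by rewrite inE qp orbT.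
  by exists u, v; rewrite inE up orbT inE vp orbT.
pose r i := xchoose (finset.set0Pn _ (ne i)).
have rB i : r i \in B i by exact: xchooseP.
have walks (z : 'I_5 * 'I_5) : exists p, z.1 != z.2 ->
    [/\ path e (r z.1) p, last (r z.1) p = r z.2 & all (mem (B z.1 :|: B z.2)) (r z.1 :: p)].
  case: z => i j /=; case: (boolP (i == j)) => [|ij]; first by exists [::].
  have [p hp] := adjacent_walk (conn i) (conn j) (adj i j ij) (rB i) (rB j).
  by exists p.
have {walks}[p hp] := choice walks.
apply: (@lattice_K5 (fun i => loc (r i)) (fun i j => walk_lift W (r i) (p (i, j)))) => [i j ij|i j k l uq q].
  by have [pp lp _] := hp (i, j) ij; rewrite -lp; exact: liftP.
have [ij kl [ik il jk jl]] : [/\ i != j, k != l & [/\ i != k, i != l, j != k & j != l]].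
  by move: uq; rewrite /= !inE !negb_or => /and4P[/and3P[-> -> ->] /andP[-> ->] -> _].
have [pij lij sij] := hp (i, j) ij; have [pkl lkl skl] := hp (k, l) kl.
(* Distinct branch sets are disjoint, so a branch path has at least one edge, as [lift_mem]
   requires. *)
have nonnil a b : a != b -> last (r a) (p (a, b)) = r b -> p (a, b) != [::].
  move=> ab; apply: contraPneq => -> /= eq_r.
  by have /pred0P/(_ (r a)) := disj a b ab; rewrite /= rB eq_r rB.
have apart u v : u \in r i :: p (i, j) -> v \in r k :: p (k, l) -> u != v.
  move=> /(allP sij) /= uB /(allP skl) /= vB; apply: contraTneq vB => <-.
  move: uB; rewrite !inE => /orP[] uB; rewrite negb_or.
    by rewrite (disjointFr (disj _ _ ik) uB) (disjointFr (disj _ _ il) uB).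
  by rewrite (disjointFr (disj _ _ jk) uB) (disjointFr (disj _ _ jl) uB).
move=> /(lift_mem _ _ _ pij (nonnil _ _ ij lij))[u [v [ui vi uv qW]]].
apply/negP => /(lift_mem _ _ _ pkl (nonnil _ _ kl lkl))[x [y [xk yk xy]]].
by apply/negP; apply: disjW uv xy _ q qW; rewrite /vertex_disjoint !apart.
Qed.

(** * Breadth-first layers and trees *)

Section Layers.
Variables (T : finType) (e : rel T).
Hypothesis symE : symmetric e.
Variables (S : {set T}) (r : T).
Hypotheses (rS : r \in S) (connS : forall v, v \in S -> connect (within_rel e S) r v).

(** Take for [d] the distance from [r] inside [S] and for [par v] the last but one vertex of a
    shortest walk to [v]; the values outside [S] are arbitrary. *)
Lemma bfs_layers : exists (d : T -> nat) (par : T -> T),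
  [/\ d r = 0,
     forall v, v \in S -> v != r -> [/\ par v \in S, e v (par v) & d v = (d (par v)).+1]
   & forall x y, x \in S -> y \in S -> e x y -> d y <= (d x).+1].
Proof.
have exd v : exists d, v \in S -> dist_le e S r v d /\ forall k, dist_le e S r v k -> d <= k.
  case: (boolP (v \in S)) => vS; last by exists 0.
  have exk : exists k, `[< dist_le e S r v k >].
    have /(connect_withinP _ _ rS)[p [pp lp pS]] := connS vS.
    by exists (size p); apply/asboolP; exists p.
  exists (ex_minn exk) => _; case: ex_minnP => k /asboolP hk mink.
  by split=> // k' /asboolT; exact: mink.
have {exd}[d hd] := choice exd.
have lip x y : x \in S -> y \in S -> e x y -> d y <= (d x).+1.
  move=> xS yS xy; have [[p [pp lp pS sp]] _] := hd x xS; apply: (hd y yS).2.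
  exists (rcons p y); split; rewrite ?rcons_path ?last_rcons ?lp ?pp ?size_rcons //.
  by rewrite -rcons_cons all_rcons pS andbT.
have d0 : d r = 0.
  by apply/eqP; rewrite -leqn0; apply: (hd r rS).2; exists [::]; rewrite /= rS.
have expar v : exists u, v \in S -> v != r -> [/\ u \in S, e v u & d v = (d u).+1].
  case: (boolP ((v \in S) && (v != r))) => [/andP[vS vr]|nh]; last first.
    by exists v => vS vr; move: nh; rewrite vS vr.
  have [[p [pp lp pS sp]] _] := hd v vS; move: pp lp pS sp.
  case/lastP: p => [_ /= rv|p u]; first by rewrite rv eqxx in vr.
  rewrite rcons_path last_rcons -rcons_cons all_rcons size_rcons => /andP[pp uv] eq_uv /andP[_ pS] sp.
  rewrite {u}eq_uv in uv; have lS : last r p \in S by apply: (allP pS); exact: mem_last.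
  exists (last r p) => _ _; split; rewrite ?(symE v) //.
  apply/eqP; rewrite eqn_leq lip //=; apply: leq_trans sp; rewrite ltnS.
  by apply: (hd _ lS).2; exists p.
by have [par hpar] := choice expar; exists d, par; split.
Qed.

(** The tree consists of the edges from each vertex to its parent. Its path from the root to [v] has
    [d v] edges, and no walk in [S] is shorter since [d] grows by at most one along an edge. *)
Lemma bfs_tree_exists : exists t : rtree T,
  [/\ is_bfs_tree e t, rt_root t = r & rt_verts t = S].
Proof.
have [d [par [d0 parP lip]]] := bfs_layers.
pose child x y := [&& x \in S, x != r & par x == y].
pose f : rel T := fun x y => child x y || child y x.
have childP x y : child x y -> [/\ e x y, x \in S, y \in S & d x = (d y).+1].
  by move=> /and3P[xS xr /eqP <-]; have [? ? ?] := parP x xS xr.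
have fP x y : f x y -> [/\ e x y, x \in S & y \in S].
  by case/orP => /childP[? ? ? _]; split=> //; rewrite symE.
have fsym x y : f x y = f y x by rewrite /f orbC.
have down v : v \in S -> exists p, [/\ path f v p, last v p = r, all (mem S) (v :: p) & size p = d v].
  move dv : (d v) => n; elim: n v dv => [|n IH] v dv vS.
    exists [::]; split; rewrite //= ?vS //; apply/eqP/negPn/negP => vr.
    by have [_ _] := parP v vS vr; rewrite dv.
  have vr : v != r by apply/negP => /eqP vr; rewrite vr d0 in dv.
  have [pS vp dp] := parP v vS vr; move: dp; rewrite dv => -[/esym dp].
  have [p [pp lp allp sp]] := IH _ dp pS.
  exists (par v :: p); split; rewrite //= ?sp ?pp ?vS ?andbT //.
  by rewrite /f /child vS vr eqxx.
have up v : v \in S -> exists p, [/\ path f r p, last r p = v, all (mem S) (r :: p) & size p = d v].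
  move=> /down[p [pp lp pS sp]]; have [q] := rev_walk fsym pp; rewrite lp sp => -[pq lq qp sq].
  by exists q; rewrite (eq_all_r qp).
have dlip p x : path e x p -> all (mem S) (x :: p) -> d (last x p) <= d x + size p.
  elim: p x => [|y p IH] x /=; first by rewrite addn0.
  move=> /andP[xy pp] /and3P[xS yS pS].
  apply: leq_trans (IH y pp _) _; first by rewrite /= yS.
  by rewrite addnS -addSn leq_add2r lip.
exists (RTree r S f); split => //; split => /=; first split => /=.
- exact: rS.
- by move=> x y /fP[-> -> ->].
- exact: fsym.
- move=> x y /down[p [pp lp _ _]] /up[q [pq lq _ _]].
  by exists (p ++ q); rewrite cat_path last_cat lp pp lq.
- move=> x p pp up_ sp; apply/negP => lx.
  have cyc : cycle f (x :: p) by rewrite /= rcons_path pp.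
  (* Both cycle neighbours of a deepest vertex are its parent. *)
  have [m mp maxm] : exists2 m, m \in x :: p & forall y, y \in x :: p -> d y <= d m.
    by case: (@arg_maxnP _ x (mem (x :: p)) d (mem_head x p)) => m; exists m.
  have [i s' rotm] := rot_to mp.
  have mems y : y \in m :: s' -> y \in x :: p by rewrite -rotm mem_rot.
  have uniqs : uniq (m :: s') by rewrite -rotm rot_uniq.
  have : cycle f (m :: s') by rewrite -rotm rot_cycle.
  have : size (m :: s') = (size p).+1 by rewrite -rotm size_rot.
  have to_par y : y \in m :: s' -> f m y -> y = par m.
    move=> /mems /maxm le_ym /orP[/and3P[_ _ /eqP //]|/childP[_ _ _ dy]].
    by rewrite dy ltnn in le_ym.
  case: s' rotm uniqs mems to_par => [|a [|b s']] rotm uniqs mems to_par /= [sz].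
  + by rewrite -sz in sp.
  + by rewrite -sz in sp.
  rewrite rcons_path => /and3P[ma _ /andP[_ lm]].
  have al : a = last b s'.
    rewrite (to_par a) ?inE ?eqxx ?orbT // [RHS]to_par //; last by rewrite fsym.
    by rewrite 2!in_cons mem_last !orbT.
  by move: uniqs => /and3P[_]; rewrite al mem_last.
move=> v vS k; split=> [[p [pp lp pS sp]]|[p [pp lp pS sp]]].
  by exists p; split=> //; apply: sub_path pp => x y /fP[].
have [q [pq lq qS sq]] := up v vS.
exists q; split=> //; rewrite sq; apply: leq_trans sp.
by have := dlip p r pp pS; rewrite lp d0.
Qed.

End Layers.

(** * Decomposition into unions of geodesics *)

Section Decomposition.
Variables (T : finType) (e : rel T).
Hypothesis symE : symmetric e.
Hypothesis noK5 : forall B : 'I_5 -> {set T},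
  (forall i, B i != finset.set0) -> (forall i, connected_in e (B i)) ->
  (forall i j, i != j -> [disjoint B i & B j]) ->
  (forall i j, i != j -> adjacent e (B i) (B j)) -> False.
Implicit Types (idx : T -> nat) (m : nat) (x y z w : T).

Definition part idx i : {set T} := [set x | idx x == i]%SET.
Definition above idx i : {set T} := [set x | i <= idx x]%SET.

Definition touches idx m x i := exists w z,
  [/\ connect (within_rel e (above idx m)) x w, e w z & idx z = i].

(* [lab] names one of three geodesics covering part [i], and [pos] is the distance
   to their common end. *)
Definition good_part idx i :=
  (exists2 nb : seq nat, size nb <= 3 &
     forall x j, idx x = i -> j < i -> touches idx i x j -> j \in nb) /\
  (exists (lab : T -> 'I_3) (pos : T -> nat),
     (forall x y, i <= idx x -> i <= idx y -> e x y -> pos y <= (pos x).+1) /\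
     (forall x y, idx x = i -> idx y = i -> lab x = lab y -> pos x = pos y -> x = y)).

(** The index [m] marks the vertices not yet removed, so [touches idx m x i] says that the component
    of [x] in the remaining graph is adjacent to part [i]. The third clause is what produces clique
    minors. *)
Definition invariant m idx :=
  [/\ forall x, idx x <= m,
     forall i, i < m -> part idx i != finset.set0 /\ connected_in e (part idx i),
     forall x i j, idx x = m -> i < j -> j < m -> touches idx m x i -> touches idx m x j ->
       adjacent e (part idx i) (part idx j)
   & forall i, i < m -> good_part idx i].

(** Follow the parents of a breadth-first search of [C] from each [a k] to the root [a ord0]. Depth
    serves as [pos]: it is 1-Lipschitz on all of [C] and determines a vertex of a given chain. *)
Lemma geodesic_union (C : {set T}) (a : 'I_3 -> T) :
  (forall k, a k \in C) -> connected_in e C ->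
  exists (H : {set T}) (lab : T -> 'I_3) (pos : T -> nat),
    [/\ H \subset C /\ (forall k, a k \in H), connected_in e H,
        forall x y, x \in C -> y \in C -> e x y -> pos y <= (pos x).+1
      & forall x y, x \in H -> y \in H -> lab x = lab y -> pos x = pos y -> x = y].
Proof.
move=> aC connC; pose r := a ord0.
have [d [par [d0 parP lip]]] := bfs_layers symE (aC ord0) (fun v vC => connC _ v (aC ord0) vC).
have iterP v n : v \in C -> n <= d v -> iter n par v \in C /\ d (iter n par v) = d v - n.
  move=> vC; elim: n => [|n IH] lt_n /=; first by rewrite subn0.
  have [nC dn] := IH (ltnW lt_n).
  have nr : iter n par v != r.
    by apply/negP => /eqP nr; rewrite nr d0 in dn; move: lt_n; rewrite ltnNge -subn_eq0 -dn.
  by have [pC _] := parP _ nC nr; rewrite dn subnS => ->.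
pose onchain x (k : 'I_3) := exists2 n, n <= d (a k) & x = iter n par (a k).
pose H : {set T} := [set x | `[< exists k, onchain x k >]]%SET.
have HP x : x \in H -> exists k, onchain x k by rewrite inE => /asboolP.
have HI x k : onchain x k -> x \in H by move=> xk; rewrite inE; apply/asboolP; exists k.
have HC x : x \in H -> x \in C.
  by move=> /HP[k [n lt_n ->]]; have [] := iterP _ n (aC k) lt_n.
have aH k : a k \in H by apply: (HI _ k); exists 0.
have toroot x : x \in H -> connect (within_rel e H) x r.
  move dx : (d x) => n; elim: n x dx => [|n IH] x dx xH.
    suff -> : x = r by exact: connect0.
    apply/eqP/negPn/negP => xr; have [_ _] := parP x (HC x xH) xr.
    by rewrite dx.
  have xr : x != r by apply/negP => /eqP xr; rewrite xr d0 in dx.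
  have [pC xp] := parP x (HC x xH) xr; rewrite dx => -[/esym dp].
  have pH : par x \in H.
    have [k [n' lt_n' eq_x]] := HP x xH; apply: (HI _ k); exists n'.+1; rewrite /= -?eq_x //.
    have [_] := iterP _ _ (aC k) lt_n'; rewrite -eq_x dx => eq_d.
    by rewrite ltnNge -subn_eq0 -eq_d.
  apply: connect_trans (IH _ dp pH); apply: connect1.
  by rewrite /within_rel xp xH.
have /choice[lab labP] : forall x, exists k, x \in H -> onchain x k.
  by move=> x; case: (boolP (x \in H)) => [/HP[k xk]|_]; [exists k | exists ord0].
exists H, lab, d; split=> //.
- by split=> //; apply/fintype.subsetP.
- move=> x y xH yH; apply: (connect_trans (toroot x xH)).
  by rewrite within_sym //; exact: toroot.
- move=> x y xH yH eq_lab; have [n lt_n ->] := labP x xH; have [n' lt_n' ->] := labP y yH.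
  rewrite eq_lab in lt_n *.
  have [_ ->] := iterP _ _ (aC (lab y)) lt_n; have [_ ->] := iterP _ _ (aC (lab y)) lt_n'.
  by move=> eq_n; have -> : n = n' by move: lt_n lt_n' eq_n; lia.
Qed.

(** Four earlier parts adjacent to the component of [x] would form a [K_5] minor with it; the
    component takes the last index of ['I_5]. *)
Lemma touches_few idx m x (J : seq nat) : invariant m idx -> idx x = m ->
  uniq J -> (forall j, j \in J -> j < m /\ touches idx m x j) -> size J <= 3.
Proof.
move=> [_ parts adj _] xm uJ JP; rewrite leqNgt; apply/negP => ltJ.
have xA : x \in above idx m by rewrite inE xm.
pose C := component e (above idx m) x; have CA : C \subset above idx m by exact: component_sub.
pose n (k : 'I_5) := nth 0 J k.
have nJ (k : 'I_5) : k < 4 -> n k \in J by move=> k4; apply: mem_nth; apply: leq_trans ltJ.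
pose B (k : 'I_5) := if k < 4 then part idx (n k) else C.
have k4 (k : 'I_5) : k < 4 = false -> k = ord_max.
  by move=> h; apply/val_inj => /=; have := ltn_ord k; lia.
have symB (Q : 'I_5 -> 'I_5 -> Prop) : (forall i j : 'I_5, Q i j -> Q j i) ->
    (forall i j : 'I_5, i < j -> j < 4 -> Q i j) ->
    (forall i j : 'I_5, i < 4 -> j < 4 = false -> Q i j) ->
    forall i j : 'I_5, i != j -> Q i j.
  move=> symQ Q1 Q2 i j ij.
  case i4 : (i < 4); case j4 : (j < 4).
  - case: (ltngtP i j) => [lt|gt|eq]; [exact: Q1|by apply: symQ; exact: Q1|].
    by move: ij; rewrite (val_inj eq) eqxx.
  - exact: Q2.
  - by apply: symQ; exact: Q2.
  - by move: ij; rewrite (k4 i i4) (k4 j j4) eqxx.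
have n_neq (i j : 'I_5) : i < j -> j < 4 -> n i != n j.
  move=> ij j4; have jJ : j < size J by exact: leq_trans j4 ltJ.
  by rewrite /n nth_uniq ?(ltn_trans ij jJ) // (ltn_eqF ij).
apply: (noK5 (B := B)).
- move=> k; rewrite /B; case: ifP => [/nJ/JP[lt_m _]|_]; first by have [] := parts _ lt_m.
  by apply/finset.set0Pn; exists x; rewrite inE connect0.
- move=> k; rewrite /B; case: ifP => [/nJ/JP[lt_m _]|_]; first by have [] := parts _ lt_m.
  exact: component_connected.
- apply: symB => [i j|i j ij j4|i j i4 j4]; first by rewrite disjoint_sym.
    rewrite /B (ltn_trans ij j4) j4; apply/pred0P => y /=; rewrite !inE.
    by apply/negP => /andP[/eqP -> ]; apply/negP; exact: n_neq.
  rewrite /B i4 j4; apply/pred0P => y /=; apply/negP => /andP[].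
  rewrite inE => /eqP yi /(fintype.subsetP CA); rewrite inE yi.
  by have [] := JP _ (nJ i i4); rewrite ltnNge => /negP.
- apply: symB => [i j|i j ij j4|i j i4 j4]; first exact: adjacent_sym.
    rewrite /B (ltn_trans ij j4) j4.
    have [im ti] := JP _ (nJ i (ltn_trans ij j4)); have [jm tj] := JP _ (nJ j j4).
    case: (ltngtP (n i) (n j)) (n_neq i j ij j4) => // lt_n _; first by apply: (adj x).
    by apply: adjacent_sym => //; apply: (adj x).
  rewrite /B i4 j4; have [_ [w [z [xw wz zi]]]] := JP _ (nJ i i4).
  by exists z, w; rewrite symE !inE zi eqxx.
Qed.

Lemma good_part_ext idx idx' i :
  (forall x, (i <= idx' x) = (i <= idx x)) ->
  (forall x, (idx' x == i) = (idx x == i)) ->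
  (forall x, idx' x < i -> idx x = idx' x) ->
  good_part idx i -> good_part idx' i.
Proof.
move=> ge_i eq_i lt_i [[nb nb3 nbP] [lab [pos [lip inj]]]]; split.
  exists nb => // x j /eqP; rewrite eq_i => /eqP xi ji [w [z [xw wz zj]]].
  apply: (nbP x) => //; exists w, z; split=> //; last by rewrite lt_i ?zj.
  suff <- : above idx' i = above idx i by [].
  by apply/setP => y; rewrite !inE ge_i.
exists lab, pos; split=> [x y|x y]; first by rewrite !ge_i; exact: lip.
by move=> /eqP; rewrite eq_i => /eqP xi /eqP; rewrite eq_i => /eqP yi; exact: inj.
Qed.

(** The new part [H] lies in the component [C] of [x0] and contains a neighbour of every earlier
    part adjacent to [C]; the rest of the remaining vertices move on to index [m.+1]. *)
Lemma invariant_step m idx x0 : invariant m idx -> idx x0 = m ->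
  exists idx', invariant m.+1 idx' /\
    #|part idx' m.+1| < #|part idx m|.
Proof.
move=> inv x0m; have [le_m parts adj good] := inv.
have x0A : x0 \in above idx m by rewrite inE x0m.
pose C := component e (above idx m) x0.
have CA w : w \in C -> idx w = m.
  rewrite inE => /(connect_within_mem x0A); rewrite inE => mw.
  by apply/eqP; rewrite eqn_leq le_m.
have CE w z : w \in C -> e w z -> idx z = m -> z \in C.
  move=> wC wz zm; move: (wC); rewrite !inE => /connect_trans; apply; apply: connect1.
  by rewrite /within_rel wz !inE (CA w wC) zm leqnn.
have connC : connected_in e C by exact: component_connected.
pose J := [seq j <- iota 0 m | `[< touches idx m x0 j >]].
have JP j : j \in J <-> j < m /\ touches idx m x0 j.
  rewrite mem_filter mem_iota add0n /=; split=> [/andP[/asboolP]|[jm /asboolP ->]] //.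
have J3 : size J <= 3.
  apply: (touches_few inv x0m); first by rewrite filter_uniq ?iota_uniq.
  by move=> j /JP.
(* If fewer than three earlier parts touch [C], the spare end points are set to [x0]. *)
have /choice[a aP] : forall k : 'I_3, exists w, w \in C /\
    (k < size J -> exists2 z, e w z & idx z = nth 0 J k).
  move=> k; case: (ltnP k (size J)) => [kJ|_]; last by exists x0; rewrite inE connect0.
  have /JP[_ [w [z [xw wz zk]]]] := mem_nth 0 kJ.
  by exists w; rewrite inE; split=> // _; exists z.
have [H [lab [pos [[HC aH] connH lip inj]]]] := geodesic_union (fun k => (aP k).1) connC.
have Hm w : w \in H -> idx w = m by move=> /(fintype.subsetP HC) /CA.
pose idx' x := if (idx x == m) && (x \notin H) then m.+1 else idx x.
have ge_i i x : i <= m -> (i <= idx' x) = (i <= idx x).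
  by rewrite /idx'; case: ifP => // /andP[/eqP -> _] im; rewrite im leqW.
have lt_i x : idx' x < m -> idx x = idx' x.
  by rewrite /idx'; case: ifP => // _; rewrite ltnNge leqnSn.
have eq_i i x : i < m -> (idx' x == i) = (idx x == i).
  by rewrite /idx'; case: ifP => // /andP[/eqP -> _] im; rewrite !gtn_eqF // ltnW.
have eq_m x : (idx' x == m) = (x \in H).
  rewrite /idx'; case: (boolP (x \in H)) => [xH|xH]; first by rewrite andbF (Hm x xH) eqxx.
  by rewrite andbT; case: ifP => [_|->//]; rewrite gtn_eqF.
have eq_mS x : (idx' x == m.+1) = (idx x == m) && (x \notin H).
  rewrite /idx'; case: ifP => [_|_]; first by rewrite eqxx.
  by rewrite ltn_eqF // ltnS.
have aboveE i : i <= m -> above idx' i = above idx i.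
  by move=> im; apply/setP => y; rewrite !inE ge_i.
have aboveS : above idx' m.+1 \subset above idx m.
  by rewrite -aboveE //; apply/fintype.subsetP => y; rewrite !inE; exact: ltnW.
have partE i : i < m -> part idx' i = part idx i.
  by move=> im; apply/setP => y; rewrite !inE eq_i.
have partm : part idx' m = H by apply/setP => y; rewrite inE eq_m.
exists idx'; split; last first.
  apply: proper_card; apply/fintype.properP; split.
    by apply/fintype.subsetP => y; rewrite !inE eq_mS => /andP[].
  by exists (a ord0); rewrite !inE ?eq_mS ?aH ?andbF // Hm.
split.
- by move=> x; rewrite /idx'; case: ifP => // _; exact: leqW.
- move=> i; rewrite ltnS leq_eqVlt => /predU1P[->|im]; last by rewrite partE //; exact: parts.
  by rewrite partm; split=> //; apply/finset.set0Pn; exists (a ord0).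
- move=> x i j /eqP; rewrite eq_mS => /andP[/eqP xm xH] ij.
  have touchE k : k < m -> touches idx' m.+1 x k -> touches idx m x k.
    move=> km [w [z [xw wz /eqP]]]; rewrite eq_i // => /eqP zk.
    by exists w, z; split=> //; apply: within_relS xw.
  rewrite ltnS leq_eqVlt => /predU1P[jm|jm]; last first.
    have im := ltn_trans ij jm.
    by rewrite !partE // => /(touchE _ im) ti /(touchE _ jm) tj; apply: (adj x).
  (* The component of [x] touches the new part, so it lies in [C]. Hence part [i] touches [C],
     occurs in [J], and is adjacent to one of the end points [a k] of [H]. *)
  rewrite jm in ij *; move=> /(touchE _ ij) [w' [z' [xw' wz' zi']]] [w [z [xw wz /eqP]]].
  rewrite eq_m partm partE // => zH.
  have xw1 := within_relS aboveS xw.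
  have xA : x \in above idx m by rewrite inE xm.
  have wm : idx w = m.
    by have := connect_within_mem xA xw1; rewrite inE => mw; apply/eqP; rewrite eqn_leq le_m.
  have wC : w \in C by apply: (CE z); rewrite ?(fintype.subsetP HC) // symE.
  have /JP iJ : i < m /\ touches idx m x0 i.
    split=> //; exists w', z'; split=> //; move: wC; rewrite inE => x0w.
    by apply: (connect_trans x0w); apply: connect_trans xw'; rewrite within_sym.
  have ltiJ : index i J < 3 by apply: leq_trans J3; rewrite index_mem.
  have [|z1 wz1 zi1] := (aP (Ordinal ltiJ)).2; first by rewrite /= index_mem.
  exists z1, (a (Ordinal ltiJ)); split=> //; last by rewrite symE.
  by rewrite inE zi1 nth_index.
- move=> i; rewrite ltnS leq_eqVlt => /predU1P[->|im]; last first.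
    apply: (good_part_ext (idx := idx)); last exact: good.
    + by move=> y; rewrite ge_i // ltnW.
    + by move=> y; rewrite eq_i.
    + by move=> y yi; apply: lt_i; apply: ltn_trans im.
  split.
    exists J => // x j /eqP; rewrite eq_m => xH jm [w [z [xw wz zj]]]; apply/JP; split=> //.
    exists w, z; split=> //; last by rewrite lt_i zj.
    move: (fintype.subsetP HC _ xH); rewrite inE => /connect_trans; apply.
    by rewrite -aboveE.
  (* Outside [C] the position is set to 0. This keeps the Lipschitz condition, because no edge joins
     [C] to another remaining vertex. *)
  exists lab, (fun y => if y \in C then pos y else 0); split=> [x y|x y].
    rewrite !ge_i // => mx my xy.
    have [xm ym] : idx x = m /\ idx y = m by split; apply/eqP; rewrite eqn_leq le_m.
    case: (boolP (x \in C)) => xC; first by rewrite (CE x y) //; apply: lip => //; exact: (CE x).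
    by case: ifP => // yC; rewrite (CE y x) // symE in xC.
  move=> /eqP; rewrite eq_m => xH /eqP; rewrite eq_m => yH.
  by rewrite !(fintype.subsetP HC) //; exact: inj.
Qed.

(** Induction on the number of remaining vertices. Once none remain, the parts with index at least
    [m] are empty and trivially good. *)
Lemma decomposition : exists idx, forall i, good_part idx i.
Proof.
suff loop n m idx : #|part idx m| <= n -> invariant m idx ->
    exists idx, forall i, good_part idx i.
  apply: (loop #|T| 0 (fun=> 0)); first exact: max_card.
  by split.
elim: n m idx => [|n IH] m idx.
  rewrite leqn0 cards_eq0 => /eqP undone [le_m _ _ good]; exists idx => i.
  case: (ltnP i m) => [im|mi]; first exact: good.
  have empty x : idx x <> i.
    move=> xi; have : x \in part idx m by rewrite inE eqn_leq le_m xi.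
    by rewrite undone inE.
  split; first by exists [::] => // x j /empty.
  by exists (fun=> ord0), (fun=> 0); split=> // x y /empty.
move=> le_n inv; case: (finset.set_0Vmem (part idx m)) => [p0|[x]].
  by apply: (IH m idx) => //; rewrite p0 cards0.
rewrite inE => /eqP xm; have [idx' [inv' lt']] := invariant_step inv xm.
by apply: (IH m.+1 idx') => //; rewrite -ltnS; exact: leq_trans le_n.
Qed.

End Decomposition.

(** * Colouring the centres *)

Lemma fresh_colour (s : seq nat) : exists2 c, c <= size s & c \notin s.
Proof.
case: (boolP (all (mem s) (iota 0 (size s).+1))) => [/allP sub|/allPn[c]].
  by have := uniq_leq_size (iota_uniq 0 (size s).+1) sub; rewrite size_iota ltnn.
by rewrite mem_iota add0n ltnS => /andP[_ lt_c] cs; exists c.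
Qed.

Lemma greedy_colouring (back : nat -> seq nat) (K n : nat) :
  (forall i, size (back i) <= K) ->
  exists f : nat -> nat, (forall i, f i <= K) /\
    (forall i j, i < n -> j < i -> j \in back i -> f j != f i).
Proof.
move=> backK; elim: n => [|n [f [fK fP]]]; first by exists (fun=> 0).
have [c cK cP] := fresh_colour (map f (back n)).
exists (fun i => if i == n then c else f i); split=> [i|i j].
  by case: ifP => // _; apply: leq_trans cK _; rewrite size_map.
rewrite ltnS leq_eqVlt => /predU1P[->|lt_in] ji jb.
  by rewrite eqxx (ltn_eqF ji); apply: contraNneq cP => <-; exact: map_f.
by rewrite (ltn_eqF lt_in) (ltn_eqF (ltn_trans ji lt_in)); exact: fP.
Qed.

(** The parts that can be seen from part [i] by passing at most [n] times to an earlier part listed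
    in [nb]. *)
Fixpoint reach (nb : nat -> seq nat) (n i : nat) : seq nat :=
  if n is n'.+1 then i :: flatten [seq reach nb n' j | j <- nb i] else [:: i].

Lemma size_reach (nb : nat -> seq nat) (k n i : nat) :
  (forall i, size (nb i) <= k) -> size (reach nb n i) <= k.+1 ^ n.
Proof.
move=> nbk; elim: n i => [|n IH] i //=.
rewrite expnS mulSn -add1n leq_add ?expn_gt0 //.
rewrite size_flatten /shape -map_comp; apply: (@leq_trans (size (nb i) * k.+1 ^ n)); last first.
  by rewrite leq_mul2r nbk orbT.
by elim: (nb i) => [|j s IHs] //=; rewrite mulSn leq_add.
Qed.

Section Colouring.
Variables (T : finType) (e : rel T) (idx : T -> nat).
Implicit Types (x y v : T) (p : seq T).

Definition stays_above i x p := path e x p && all (fun y => i <= idx y) (x :: p).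

(** Let [z] be the first vertex of the walk with index below [idx x]. Up to there the walk stays
    above [idx x], so part [idx z] is touched and listed in [nb]; at least one edge is used up, and
    the argument continues from [z]. *)
Lemma walk_reach (nb : nat -> seq nat) :
  (forall i x j, idx x = i -> j < i -> touches e idx i x j -> j \in nb i) ->
  forall n i x p, stays_above i x p -> size p <= n -> idx (last x p) = i ->
  i \in reach nb n (idx x).
Proof.
move=> nbP; elim=> [|n IH] i x p.
  by move=> _; rewrite leqn0 size_eq0 => /eqP -> /= ->; rewrite inE.
move=> /andP[pp pA] sp lp; rewrite /= inE.
case: eqVneq => //= ne_i; have {ne_i} lt_i : i < idx x.
  by rewrite ltn_neqAle ne_i; move: pA => /= /andP[].
have hp : has (fun z => idx z < idx x) p.
  apply/hasP; exists (last x p); last by rewrite lp.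
  by case: (p) lp lt_i => [|z p'] /= lp; [rewrite lp ltnn | rewrite mem_last].
case: (split_find hp) pp pA sp lp => z p1 p2 ltz nhas.
rewrite cat_rcons cat_path last_cat /= => /and3P[pp1 wz pp2].
rewrite all_cat /= => /and4P[xi _ zi p2i]; rewrite size_cat /= => sp lp.
have tz : touches e idx (idx x) x (idx z).
  exists (last x p1), z; split=> //.
  apply/(connect_withinP _ _); first by rewrite inE.
  exists p1; split=> //=; rewrite inE leqnn /=.
  by apply/allP => y yp1; rewrite /= inE leqNgt; apply: contra nhas => ?; apply/hasP; exists y.
apply/flattenP; exists (reach nb n (idx z)); first by apply/map_f/nbP.
apply: (IH _ _ p2) => //; first by rewrite /stays_above pp2 /= zi.
by move: sp; lia.
Qed.

Lemma label_walk i (pos : T -> nat) x p :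
  (forall x y, i <= idx x -> i <= idx y -> e x y -> pos y <= (pos x).+1) ->
  stays_above i x p -> pos (last x p) <= pos x + size p.
Proof.
move=> lip; elim: p x => [|y p IH] x; first by rewrite addn0.
move=> /andP[/= /andP[xy pp] /and3P[xi yi pi]].
apply: (leq_trans (IH y _)); first by rewrite /stays_above pp /= yi.
by rewrite /= addnS -addSn leq_add2r; exact: lip.
Qed.

Hypothesis symE : symmetric e.

Lemma stays_above_rev i x y p : stays_above i x p -> last x p = y ->
  exists q, [/\ stays_above i y q, last y q = x & size q = size p].
Proof.
move=> /andP[pp pi] <-; have [q [pq lq qp sq]] := rev_walk symE pp.
by exists q; split=> //; rewrite /stays_above pq (eq_all_r qp).
Qed.

(** Such a walk from [x] to [y] exists when the balls of radius [D] around the two centres meet,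
    whence the bound [D.*2]. *)
Definition separates (D : nat) (K : Type) (col : T -> K) :=
  forall x y p, col x = col y -> idx y <= idx x -> stays_above (idx y) x p ->
    last x p = y -> size p <= D.*2 -> x = y.

(** A colour records a greedy colour of the part, the geodesic, and the position modulo [D.*2.+1].
    The first excludes centres in different parts. In one part and on one geodesic, the positions
    differ by at most [D.*2] and are congruent, hence equal. *)
Lemma good_parts_colouring (D : nat) : (forall i, good_part e idx i) ->
  exists col : T -> 'I_(4 ^ D.*2).+1 * 'I_3 * 'I_D.*2.+1, separates D col.
Proof.
move=> good.
have /choice[nb nbP] : forall i, exists nb : seq nat, size nb <= 3 /\
    forall x j, idx x = i -> j < i -> touches e idx i x j -> j \in nb.
  by move=> i; have [[nb ? ?] _] := good i; exists nb.
have /choice[lp lpP] : forall i, exists lp : (T -> 'I_3) * (T -> nat),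
    (forall x y, i <= idx x -> i <= idx y -> e x y -> lp.2 y <= (lp.2 x).+1) /\
    (forall x y, idx x = i -> idx y = i -> lp.1 x = lp.1 y -> lp.2 x = lp.2 y -> x = y).
  by move=> i; have [_ [lab [pos h]]] := good i; exists (lab, pos).
have [f [fK fP]] := greedy_colouring (\max_x idx x).+1
  (fun i => size_reach D.*2 i (fun i => (nbP i).1)).
exists (fun x => (inord (f (idx x)), (lp (idx x)).1 x, inord ((lp (idx x)).2 x %% D.*2.+1))).
move=> x y p [eqf eql eqp] le_yx pA lastp sp.
have {eqf} eqf : f (idx x) = f (idx y) by move: (congr1 val eqf); rewrite /= !inordK // ltnS.
have eq_idx : idx x = idx y.
  apply/eqP; rewrite eqn_leq le_yx andbT leqNgt; apply/negP => lt_yx.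
  have lt_max : idx x < (\max_z idx z).+1 by rewrite ltnS; exact: leq_bigmax.
  have back : idx y \in reach nb D.*2 (idx x).
    by apply: (walk_reach (fun i => (nbP i).2) pA) => //; rewrite lastp.
  by have := fP _ _ lt_max lt_yx back; rewrite eqf eqxx.
rewrite eq_idx in eql eqp.
have [lip inj] := lpP (idx y); apply: inj => //.
have {eqp} := congr1 val eqp; rewrite /= !inordK ?ltn_pmod // => eqp.
have d1 := label_walk lip pA; rewrite lastp in d1.
have [q [qA lastq sq]] := stays_above_rev pA lastp.
have d2 := label_walk lip qA; rewrite lastq sq in d2.
move: ((lp (idx y)).2 x) ((lp (idx y)).2 y) eqp d1 d2 => a b eqp d1 d2.
set M := D.*2.+1 in eqp; have ea := divn_eq a M; have eb := divn_eq b M; rewrite eqp in ea.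
case: (ltngtP (a %/ M) (b %/ M)) => [lt_ab|lt_ba|eq_ab]; last by rewrite ea eq_ab -eb.
  have := leq_mul lt_ab (leqnn M); rewrite mulSn.
  by move: (a %/ M * M) (b %/ M * M) (b %% M) ea eb => u v c; rewrite /M; lia.
have := leq_mul lt_ba (leqnn M); rewrite mulSn.
by move: (a %/ M * M) (b %/ M * M) (b %% M) ea eb => u v c; rewrite /M; lia.
Qed.

End Colouring.

(** * From colour classes to BFS forests *)

Section Forests.
Variables (T : finType) (e : rel T).
Hypothesis symE : symmetric e.

Lemma In_mem (U : eqType) (s : seq U) x : List.In x s <-> x \in s.
Proof.
elim: s => [|y s IH] //=; rewrite inE; split=> [[->|/IH ->]|/predU1P[->|/IH]].
- by rewrite eqxx.
- by rewrite orbT.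
- by left.
- by right.
Qed.

Lemma In_map (A B : Type) (f : A -> B) (s : seq A) (b : B) :
  List.In b (map f s) <-> exists2 a, List.In a s & f a = b.
Proof.
elim: s b => [|a s IH] b /=; first by split=> // -[].
split=> [[<-|/IH[a' a's <-]]|[a' [->|a's] <-]]; [by exists a; [left|]|by exists a'; [right|]|by left|].
by right; apply/IH; exists a'.
Qed.

Lemma dist_le_prefix (A : {set T}) r v y k p : path e r p -> last r p = v ->
  all (fun x => x \in A) (r :: p) -> size p <= k -> y \in r :: p -> dist_le e A r y k.
Proof.
move=> pp lp pA sp yp; case: (splitPl yp) pp lp pA sp => p1 p2 lp1.
rewrite cat_path size_cat -cat_cons all_cat => /andP[pp1 _] _ /andP[pA _] sp.
by exists p1; split=> //; apply: leq_trans sp; exact: leq_addr.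
Qed.

Definition ball (A : {set T}) r k : {set T} := [set v | `[< dist_le e A r v k >]]%SET.

Lemma ballP (A : {set T}) r k v : reflect (dist_le e A r v k) (v \in ball A r k).
Proof. by rewrite inE; exact: asboolP. Qed.

Lemma ball_connected (A : {set T}) r k v : r \in A -> v \in ball A r k ->
  connect (within_rel e (ball A r k)) r v.
Proof.
move=> rA /ballP[p [pp lp pA sp]].
have rB : r \in ball A r k.
  by apply/ballP; exists [::]; rewrite /= rA.
apply/(connect_withinP _ _ rB); exists p; split=> //; apply/allP => y yp.
by apply/ballP; apply: dist_le_prefix yp; eassumption.
Qed.

(** Cut the path at the root: distances from the root are exact in a BFS tree, so each half can be
    replaced by a tree walk that is no longer. *)
Lemma preserved_distance (t : rtree T) u p : is_bfs_tree e t -> path e u p ->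
  tree_preserves t (u :: p) ->
  dist_le (rt_edges t) (rt_verts t) u (last u p) (size p).
Proof.
move=> [subt bfs] pp [pS rp]; case: (splitPl rp) pp pS => p1 p2 lp1.
rewrite cat_path last_cat lp1 size_cat -cat_cons all_cat => /andP[pp1 pp2] /andP[p1S p2S].
have rS : rt_root t \in rt_verts t by case: subt.
have uS : u \in rt_verts t by move: p1S => /= /andP[].
have [q1 [pq1 lq1 q1S sq1]] : dist_le (rt_edges t) (rt_verts t) u (rt_root t) (size p1).
  apply: dist_le_sym; first by case: subt.
  by apply/bfs => //; apply: dist_le_sym => //; exists p1.
have [q2 [pq2 lq2 q2S sq2]] :
    dist_le (rt_edges t) (rt_verts t) (rt_root t) (last (rt_root t) p2) (size p2).
  apply/bfs; last by exists p2; split=> //=; rewrite rS.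
  by have := mem_last (rt_root t) p2; rewrite inE => /predU1P[->//|/(allP p2S)].
exists (q1 ++ q2); split.
- by rewrite cat_path pq1 lq1.
- by rewrite last_cat lq1.
- by rewrite -cat_cons all_cat q1S; move: q2S => /= /andP[].
- by rewrite size_cat leq_add.
Qed.

Lemma preserving_forest_dist (F : seq (rtree T)) u v p : is_bfs_forest e F ->
  path e u p -> last u p = v -> (forall k, dist_le e [set: T]%SET u v k -> size p <= k) ->
  forest_preserves F (u :: p) -> forest_dist_eq e F u v.
Proof.
move=> [bfsF _] pp lp minp [t [tF pres]]; have bfst := bfsF t tF.
exists t; split=> //; try by apply: (allP pres.1); rewrite -?lp ?mem_head ?mem_last.
move=> k; split=> [[q [pq lq qS sq]]|/minp le_k].
  exists q; split=> //; last by apply/allP => x; rewrite finset.inE.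
  by apply: sub_path pq => x y xy; have [[_ h _ _ _] _] := bfst; have /and3P[] := h _ _ xy.
have [q [pq lq qS sq]] := preserved_distance bfst pp pres.
by exists q; split; rewrite -?lp //; exact: leq_trans le_k.
Qed.

Lemma geodesic_exists (D : nat) u v : dist_le e [set: T]%SET u v D ->
  exists p, [/\ path e u p, last u p = v, uniq (u :: p), size p <= D &
    forall k, dist_le e [set: T]%SET u v k -> size p <= k].
Proof.
move=> uvD; have exk : exists k, `[< dist_le e [set: T]%SET u v k >] by exists D; apply/asboolP.
case: (ex_minnP exk) => k /asboolP[p [pp lp _ sp]] mink.
have le_all k' : dist_le e [set: T]%SET u v k' -> k <= k' by move=> /asboolT; exact: mink.
case: (shortenP pp) lp => q pq uq subq lq.
have sq : size q <= size p by apply: uniq_leq_size => //; case/andP: uq.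
exists q; split=> // [|k' /le_all]; last by apply: leq_trans; exact: leq_trans sp.
by apply: leq_trans (le_all _ uvD); exact: leq_trans sp.
Qed.

(** Each colour gives one forest, with a BFS tree on the ball [S r] for every centre [r] of that
    colour. A path is preserved by the tree of its vertex of least index. *)
Lemma coloured_forests (D : nat) (idx : T -> nat) (K : finType) (col : T -> K) :
  separates e idx D col ->
  exists FF : seq (seq (rtree T)),
    [/\ size FF = #|K|, (forall F, List.In F FF -> is_bfs_forest e F)
      & forall x p, path e x p -> size p <= D -> forests_preserve FF (x :: p)].
Proof.
move=> sep; pose S r := ball (above idx (idx r)) r D.
have rA r : r \in above idx (idx r) by rewrite inE.
have rS r : r \in S r.
  by apply/ballP; exists [::]; rewrite /= rA.
have /choice[t tP] : forall r, exists t : rtree T,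
    [/\ is_bfs_tree e t, rt_root t = r & rt_verts t = S r].
  by move=> r; apply: bfs_tree_exists => // v; exact: ball_connected.
(* A common vertex of the two balls joins the centres by a walk of length at most [D.*2] that stays
   above the smaller index. *)
have disjS r r' : col r = col r' -> r != r' -> idx r' <= idx r -> [disjoint S r & S r'].
  move=> eqc ne_r le_r; apply/pred0P => v /=; apply/negP => /andP[].
  move=> /ballP[p [pp lp pA sp]] /ballP[q [pq lq qA sq]].
  have lift (i j : nat) y s : i <= j -> path e y s -> all (fun x => x \in above idx j) (y :: s) ->
      stays_above e idx i y s.
    move=> ij ps sA; rewrite /stays_above ps; apply: sub_all sA => x; rewrite inE.
    exact: leq_trans.
  have pA' := lift _ _ _ _ le_r pp pA.
  have [q' [qA' lq' sq']] := stays_above_rev symE (lift _ _ _ _ (leqnn _) pq qA) lq.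
  move: qA' pA' => /andP[pq' qA'] /andP[pp' pA'].
  case/eqP: ne_r; apply: (sep _ _ (p ++ q')) => //.
  - rewrite /stays_above cat_path pp lp pq' -cat_cons all_cat pA'.
    by move: qA' => /= /andP[].
  - by rewrite last_cat lp.
  - by rewrite size_cat sq' -addnn leq_add.
exists [seq [seq t r | r <- enum T & col r == k] | k <- enum K]; split.
- by rewrite size_map cardE.
- move=> F /In_map[k _ <-]; split=> [t' /In_map[r _ <-]|]; first by have [] := tP r.
  rewrite pairwise_map; set s := [seq r <- enum T | col r == k].
  have : pairwise (fun x y => x != y) s by rewrite -uniq_pairwise filter_uniq ?enum_uniq.
  apply: (@sub_in_pairwise _ (fun r => col r == k)); last by rewrite filter_all.
  move=> r r' /eqP rk /eqP r'k ne_r /=; have [_ _ ->] := tP r; have [_ _ ->] := tP r'.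
  have eqc : col r = col r' by rewrite rk r'k.
  case: (leqP (idx r') (idx r)) => [le_r|/ltnW le_r]; first exact: disjS.
  by rewrite disjoint_sym; apply: disjS; rewrite // eq_sym.
- move=> x p pp sp.
  case: (@arg_minnP _ x (mem (x :: p)) idx (mem_head x p)) => r rp minr.
  have [_ rt vt] := tP r.
  exists [seq t r' | r' <- enum T & col r' == col r]; split.
    by apply/In_map; exists (col r) => //; apply/In_mem; rewrite mem_enum.
  exists (t r); split; first by apply/In_map; exists r => //; apply/In_mem; rewrite mem_filter mem_enum eqxx.
  split; last by rewrite rt.
  apply/allP => y yp; rewrite vt; apply/ballP.
  have above_p z : z \in x :: p -> z \in above idx (idx r) by move=> zp; rewrite inE; exact: minr.
  case: (splitPl rp) pp sp yp above_p => p1 p2 lp1.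
  rewrite cat_path lp1 size_cat -cat_cons mem_cat => /andP[pp1 pp2] sp yp above_p.
  have aA z : z \in x :: p1 -> z \in above idx (idx r) by move=> zp; apply: above_p; rewrite mem_cat zp.
  have bA z : z \in p2 -> z \in above idx (idx r) by move=> zp; apply: above_p; rewrite mem_cat zp orbT.
  case/orP: yp => yp.
    have [q] := rev_walk symE pp1; rewrite lp1 => -[pq lq qp sq].
    apply: (@dist_le_prefix _ r x y D q) => //; last by rewrite qp.
    + by apply/allP => z; rewrite qp; exact: aA.
    + by rewrite sq; apply: leq_trans sp; exact: leq_addr.
  apply: (@dist_le_prefix _ r (last r p2) y D p2) => //.
  + by rewrite /= rA; apply/allP.
  + by apply: leq_trans sp; exact: leq_addl.
  + by rewrite inE yp orbT.
Qed.

End Forests.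

Theorem theorem2p3 :
  exists c : nat,
  forall (T : finType) (e : rel T),
    irreflexive e -> symmetric e ->
    (forall u v, connect e u v) ->
    planar e ->
    forall D : nat, is_diameter e D ->
    exists FF : seq (seq (rtree T)),
      [/\ size FF <= 2 ^ (c * D),
          (forall F, List.In F FF -> is_bfs_forest e F),
          (forall (x : T) (p : seq T), path e x p -> uniq (x :: p) -> size p <= D ->
              forests_preserve FF (x :: p))
        & (forall u v : T, exists F, List.In F FF /\ forest_dist_eq e F u v)].
Proof.
(* The constant is 5 + 2 + 2, from the bounds on the three components of a colour. *)
exists 9 => T e _ symE _ plan D [diam _].
suff [FF [sz bfsF pres]] : exists FF : seq (seq (rtree T)),
    [/\ size FF <= 2 ^ (9 * D), (forall F, List.In F FF -> is_bfs_forest e F)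
      & forall x p, path e x p -> size p <= D -> forests_preserve FF (x :: p)].
  exists FF; split=> // [x p pp _|u v]; first exact: pres.
  have [p [pp lp _ sp minp]] := geodesic_exists (diam u v).
  have [F [FFF presF]] := pres u p pp sp; exists F; split=> //.
  exact: preserving_forest_dist (bfsF F FFF) pp lp minp presF.
(* For diameter 0 only one forest is allowed, and a constant colouring works since the walks in
   [separates] are trivial. The estimates below need a positive diameter. *)
case: D diam => [|D] diam.
  have sep : separates e (fun=> 0) 0 (fun=> tt : unit).
    move=> x y p _ _ _ lp; rewrite leqn0 size_eq0 => /eqP p0.
    by rewrite p0 in lp.
  have [FF [sz bfsF pres]] := coloured_forests symE sep.
  by exists FF; split=> //; rewrite sz card_unit.
have [idx good] := decomposition symE (fun B => @planar_K5_minor_free T e B symE plan).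
have [col sep] := good_parts_colouring symE D.+1 good.
have [FF [sz bfsF pres]] := coloured_forests symE sep.
exists FF; split=> //; rewrite sz !card_prod !card_ord.
set d := D.+1; have d0 : 0 < d by [].
have b1 : (4 ^ d.*2).+1 <= 2 ^ (5 * d).
  by rewrite (_ : 4 = 2 ^ 2) // -expnM ltn_exp2l //; lia.
have b2 : 3 <= 2 ^ (2 * d) by rewrite (@leq_trans (2 ^ 2)) // leq_exp2l //; lia.
have b3 : d.*2.+1 <= 2 ^ (2 * d) by rewrite mul2n; exact: ltn_expl.
apply: (leq_trans (leq_mul (leq_mul b1 b2) b3)).
by rewrite -!expnD leq_exp2l //; lia.
Qed.
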